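(* Let $\alpha$ be a real number, and consider the symmetric functions $f_Z(x,y)=(x+y-2)^\alpha$ and $f_\chi(x,y)=(x+y)^\alpha$, so that $Z_\alpha(G)=M_{f_Z}(G)$ and $\chi_\alpha(G)=M_{f_\chi}(G)$ for connected graphs $G$ with at least three vertices; the arguments are restricted to possible degrees of adjacent vertices in such graphs, i.e. $x,y\ge 1$ with $\max\{x,y\}\ge 2$. Then: (i) for $\alpha>1$ and for $\alpha<0$, $Z_\alpha$ and $\chi_\alpha$ are escalating; moreover for $\alpha>1$ they are good escalating; (ii) for $0<\alpha<1$, $Z_\alpha$ and $\chi_\alpha$ are de-escalating.
   Context: For a connected graph $G$, $Z_\alpha(G)=\sum_{uv\in E(G)}(d(u)+d(v)-2)^\alpha$ and $\chi_\alpha(G)=\sum_{uv\in E(G)}(d(u)+d(v))^\alpha$, where $d(v)$ is the degree. For a symmetric $f$, $M_f(G)=\sum_{uv\in E(G)}f(d(u),d(v))$, and the graph invariant $M_f$ is called escalating / de-escalating / good escalating when $f$ is. $f$ is escalating if $f(x_1,x_2)+f(y_1,y_2)\ge f(x_2,y_1)+f(x_1,y_2)$ for all $x_1\ge y_1$, $x_2\ge y_2$, strictly whenever $x_1>y_1$ and $x_2>y_2$; de-escalating if the reverse inequality $\le$ holds, strictly ($<$) whenever $x_1>y_1$ and $x_2>y_2$. An escalating $f$ is good escalating if $\frac{\partial f}{\partial x}>0$, $\frac{\partial^2 f}{\partial x^2}\ge 0$, and $f(x_1+1,x_2)+f(x_1+1,y_1-1)\ge f(x_2,y_1)+f(x_1,y_1)$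 for all $x_1\ge y_1$ and $x_2\ge 1$. *)

(* Defs.v *)
From HB Require Import structures.
From mathcomp Require Import all_boot all_order all_algebra.
From mathcomp Require Import all_classical all_reals all_analysis.

Set Implicit Arguments.
Unset Strict Implicit.
Unset Printing Implicit Defensive.

Import Order.TTheory GRing.Theory Num.Theory.
Import numFieldNormedType.Exports.

Local Open Scope ring_scope.

Record sgraph := SGraph {
  vertex :> finType;
  adj : rel vertex;
  adj_sym : symmetric adj;
  adj_irrefl : irreflexive adj }.

Definition deg (G : sgraph) (v : G) : nat := #|[pred u | adj v u]|.

Definition connected_graph (G : sgraph) : Prop :=
  forall u v : G, connect (@adj G) u v.

Section Indices.
Variable R : realType.
Implicit Types (f : R -> R -> R) (I : sgraph -> R) (alpha : R).

(* Comparing ranks in the enumeration of the vertices makes every unordered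
   edge uv contribute exactly once; for symmetric f the orientation chosen
   is irrelevant. *)
Definition edge_sum (G : sgraph) (F : G -> G -> R) : R :=
  \sum_(u : G) \sum_(v : G | adj u v && (enum_rank u < enum_rank v)%N) F u v.

Definition M_ f (G : sgraph) : R :=
  edge_sum (fun u v : G => f (deg u)%:R (deg v)%:R).

Definition Z_ alpha (G : sgraph) : R :=
  edge_sum (fun u v : G => ((deg u)%:R + (deg v)%:R - 2) `^ alpha).

Definition chi_ alpha (G : sgraph) : R :=
  edge_sum (fun u v : G => ((deg u)%:R + (deg v)%:R) `^ alpha).

Definition fZ alpha : R -> R -> R := fun x y => (x + y - 2) `^ alpha.

Definition fchi alpha : R -> R -> R := fun x y => (x + y) `^ alpha.

(* The pairs (x, y) at which f is considered; the degrees of two adjacent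
   vertices of a connected graph with at least three vertices satisfy this.
   Real, not only integer, arguments are allowed. *)
Definition adm (x y : R) : Prop := [/\ 1 <= x, 1 <= y & 2 <= Num.max x y].

Definition escalating f : Prop :=
  forall x1 x2 y1 y2 : R, y1 <= x1 -> y2 <= x2 ->
    adm x1 x2 -> adm y1 y2 -> adm x2 y1 -> adm x1 y2 ->
    f x2 y1 + f x1 y2 <= f x1 x2 + f y1 y2 /\
    (y1 < x1 -> y2 < x2 -> f x2 y1 + f x1 y2 < f x1 x2 + f y1 y2).

Definition de_escalating f : Prop :=
  forall x1 x2 y1 y2 : R, y1 <= x1 -> y2 <= x2 ->
    adm x1 x2 -> adm y1 y2 -> adm x2 y1 -> adm x1 y2 ->
    f x1 x2 + f y1 y2 <= f x2 y1 + f x1 y2 /\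
    (y1 < x1 -> y2 < x2 -> f x1 x2 + f y1 y2 < f x2 y1 + f x1 y2).

(* [derive1] is total, so the existence of each partial derivative is
   required explicitly. Since (x1 + 1, y1 - 1) must be admissible, the last
   inequality only concerns y1 >= 2. *)
Definition good_escalating f : Prop :=
  [/\ escalating f,
      forall x y : R, adm x y ->
        derivable (f^~ y) x 1 /\ 0 < derive1 (f^~ y) x,
      forall x y : R, adm x y ->
        derivable (derive1 (f^~ y)) x 1 /\
        0 <= derive1 (derive1 (f^~ y)) x
    & forall x1 x2 y1 : R, y1 <= x1 -> 1 <= x2 ->
        adm (x1 + 1) x2 -> adm (x1 + 1) (y1 - 1) -> adm x2 y1 -> adm x1 y1 ->
        f x2 y1 + f x1 y1 <= f (x1 + 1) x2 + f (x1 + 1) (y1 - 1)].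

Definition presented_by I f : Prop :=
  (forall x y : R, f x y = f y x) /\
  (forall G : sgraph, connected_graph G -> (3 <= #|G|)%N -> I G = M_ f G).

(* An invariant inherits these properties from the function presenting it,
   so f is kept as an explicit parameter. *)
Definition escalating_invariant I f : Prop :=
  presented_by I f /\ escalating f.

Definition de_escalating_invariant I f : Prop :=
  presented_by I f /\ de_escalating f.

Definition good_escalating_invariant I f : Prop :=
  presented_by I f /\ good_escalating f.

End Indices.

(* Main.v *)
(** Both functions are translates [(x + y + c) `^ alpha] of a power of the sum,
    and admissible arguments keep the base positive. The (de-)escalating
    inequality is then the sign of the second difference of [t `^ alpha]; by the
    mean value theorem this is the sign of
    [alpha * ((t + h) `^ (alpha - 1) - t `^ (alpha - 1))] at some [t > 0]. *)
Require Import Defs.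
From HB Require Import structures.
From mathcomp Require Import all_boot all_order all_algebra.
From mathcomp Require Import all_classical all_reals all_analysis.
From mathcomp Require Import ring lra.

Set Implicit Arguments.
Unset Strict Implicit.
Unset Printing Implicit Defensive.

Import Order.TTheory GRing.Theory Num.Theory.
Import numFieldNormedType.Exports.

Local Open Scope ring_scope.

Section PowerFunction.
Variable R : realType.
Implicit Types a b c h k p s t x : R.

Lemma lt0_ltr_powR b s t : b < 0 -> 0 < s -> s < t -> t `^ b < s `^ b.
Proof.
move=> b0 s0 st; have t0 : 0 < t := lt_trans s0 st.
rewrite -[b]opprK powRN (powRN s) ltf_pV2 ?posrE ?powR_gt0//.
by apply: gt0_ltr_powR; rewrite ?oppr_gt0 ?nnegrE ?ltW.
Qed.

Lemma is_derive_powR_shift a c x : 0 < x + c ->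
  is_derive x 1 (fun t : R => (t + c) `^ a) (a * (x + c) `^ (a - 1)).
Proof.
move=> xc0; rewrite -[a * _]mulr1.
apply: (@is_derive1_comp _ (@powR R ^~ a) (shift c)).
  exact: is_derive1_powR.
exact: is_derive_shift.
Qed.

Lemma powR_second_difference a p h k : 0 < p -> 0 < h -> 0 < k ->
  exists2 t, 0 < t &
    (p + h + k) `^ a + p `^ a - ((p + h) `^ a + (p + k) `^ a) =
    a * ((t + h) `^ (a - 1) - t `^ (a - 1)) * k.
Proof.
move=> p0 h0 k0.
(* The left-hand side of the goal is [g (p + k) - g p], so the mean value theorem is applied to [g]
   on [[p, p + k]]. The [+ 0] lets [is_derive_powR_shift] cover both terms. *)
pose g t := (t + h) `^ a - (t + 0) `^ a.
pose dg t := a * (t + h) `^ (a - 1) - a * (t + 0) `^ (a - 1).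
have gdg t : 0 < t -> is_derive t 1 g (dg t).
  by move=> t0; apply: is_deriveB; apply: is_derive_powR_shift; lra.
have pk : p < p + k by lra.
have [||t] := @MVT _ g dg _ _ pk.
- by move=> t; rewrite in_itv/= => /andP[pt _]; apply: gdg; lra.
- apply: derivable_within_continuous => t; rewrite in_itv/= => /andP[pt _].
  have t0 : 0 < t by lra.
  by have [] := gdg t t0.
rewrite in_itv/= => /andP[pt _]; rewrite /g /dg !addr0.
have -> : p + k - p = k by ring.
move=> E.
exists t; first lra.
have -> : p + h + k = p + k + h by ring.
by rewrite mulrBr -E; ring.
Qed.

(** In the mean value formula, [a] and the increment of the power [a - 1] have the same sign: both
    are positive for [1 < a] and both negative for [a < 0]. *)
Lemma powR_second_difference_gt0 a p h k : 1 < a \/ a < 0 ->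
  0 < p -> 0 < h -> 0 < k ->
  (p + h) `^ a + (p + k) `^ a < (p + h + k) `^ a + p `^ a.
Proof.
move=> a_range p0 h0 k0; rewrite -subr_gt0.
have [t t0 ->] := powR_second_difference a p0 h0 k0.
have tth : t < t + h by lra.
rewrite pmulr_lgt0//; case: a_range => ha.
  by rewrite mulr_gt0 ?subr_gt0 ?gt0_ltr_powR ?nnegrE//; lra.
by rewrite nmulr_rgt0// subr_lt0 lt0_ltr_powR//; lra.
Qed.

(** Here [a] is positive while the exponent [a - 1] is negative, so the increment is negative. *)
Lemma powR_second_difference_lt0 a p h k : 0 < a < 1 ->
  0 < p -> 0 < h -> 0 < k ->
  (p + h + k) `^ a + p `^ a < (p + h) `^ a + (p + k) `^ a.
Proof.
move=> /andP[a0 a1] p0 h0 k0; rewrite -subr_lt0.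
have [t t0 ->] := powR_second_difference a p0 h0 k0.
by rewrite pmulr_llt0// pmulr_rlt0// subr_lt0 lt0_ltr_powR//; lra.
Qed.

End PowerFunction.

Section ShiftedSum.
Variable R : realType.
Implicit Types a c x y : R.

(** The shift [c = -2] gives [fZ] and [c = 0] gives [fchi]. *)
Definition powR_sum c a x y : R := (x + y + c) `^ a.

Lemma fchi_powR_sum a : fchi a = powR_sum 0 a.
Proof. by apply/funext => x; apply/funext => y; rewrite /powR_sum addr0. Qed.

Lemma powR_sumC c a x y : powR_sum c a x y = powR_sum c a y x.
Proof. by rewrite /powR_sum (addrC x). Qed.

(** One argument is at least 1 and the other at least 2. Any shift [c > -3] thus leaves the base
    [x + y + c] positive. *)
Lemma adm_sum_ge3 x y : adm x y -> 3 <= x + y.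
Proof. by case=> x1 y1; rewrite le_max => /orP[]; lra. Qed.

(** Settles the degenerate case of the weak inequalities, where a step of the second difference
    vanishes. *)
Lemma mixed_sum_eq (f : R -> R -> R) x1 x2 y1 y2 :
  (forall x y, f x y = f y x) -> x1 = y1 \/ x2 = y2 ->
  f x2 y1 + f x1 y2 = f x1 x2 + f y1 y2.
Proof. by move=> fC [] ->; [rewrite (fC x2)|rewrite addrC (fC y2)]. Qed.

Lemma powR_sum_escalating c a : -3 < c -> 1 < a \/ a < 0 ->
  escalating (powR_sum c a).
Proof.
move=> c3 a_range x1 x2 y1 y2 yx1 yx2 _ /adm_sum_ge3 y12 _ _.
have lt_mixed : y1 < x1 -> y2 < x2 -> powR_sum c a x2 y1 + powR_sum c a x1 y2 <
    powR_sum c a x1 x2 + powR_sum c a y1 y2.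
  move=> lt1 lt2; rewrite addrC /powR_sum.
  (* The smallest of the four bases serves as [p]; the steps [x1 - y1] and [x2 - y2] lead to the
     other three. *)
  have := @powR_second_difference_gt0 _ a (y1 + y2 + c) (x1 - y1) (x2 - y2) a_range.
  have -> : y1 + y2 + c + (x1 - y1) + (x2 - y2) = x1 + x2 + c by ring.
  have -> : y1 + y2 + c + (x1 - y1) = x1 + y2 + c by ring.
  have -> : y1 + y2 + c + (x2 - y2) = x2 + y1 + c by ring.
  by apply; lra.
split=> //.
have [e1|n1] := eqVneq x1 y1.
  by rewrite (@mixed_sum_eq _ x1 x2 y1 y2 (@powR_sumC c a))//; left.
have [e2|n2] := eqVneq x2 y2.
  by rewrite (@mixed_sum_eq _ x1 x2 y1 y2 (@powR_sumC c a))//; right.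
by apply/ltW/lt_mixed; rewrite lt_neqAle eq_sym ?n1 ?n2.
Qed.

Lemma powR_sum_de_escalating c a : -3 < c -> 0 < a < 1 ->
  de_escalating (powR_sum c a).
Proof.
move=> c3 a_range x1 x2 y1 y2 yx1 yx2 _ /adm_sum_ge3 y12 _ _.
have lt_mixed : y1 < x1 -> y2 < x2 -> powR_sum c a x1 x2 + powR_sum c a y1 y2 <
    powR_sum c a x2 y1 + powR_sum c a x1 y2.
  move=> lt1 lt2; rewrite (addrC (powR_sum c a x2 y1)) /powR_sum.
  have := @powR_second_difference_lt0 _ a (y1 + y2 + c) (x1 - y1) (x2 - y2) a_range.
  have -> : y1 + y2 + c + (x1 - y1) + (x2 - y2) = x1 + x2 + c by ring.
  have -> : y1 + y2 + c + (x1 - y1) = x1 + y2 + c by ring.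
  have -> : y1 + y2 + c + (x2 - y2) = x2 + y1 + c by ring.
  by apply; lra.
split=> //.
have [e1|n1] := eqVneq x1 y1.
  by rewrite (@mixed_sum_eq _ x1 x2 y1 y2 (@powR_sumC c a))//; left.
have [e2|n2] := eqVneq x2 y2.
  by rewrite (@mixed_sum_eq _ x1 x2 y1 y2 (@powR_sumC c a))//; right.
by apply/ltW/lt_mixed; rewrite lt_neqAle eq_sym ?n1 ?n2.
Qed.

Lemma is_derive_powR_sum c a x y : 0 < x + y + c ->
  is_derive x 1 (powR_sum c a ^~ y) (a * powR_sum c (a - 1) x y).
Proof.
have -> : powR_sum c a ^~ y = fun t => (t + (y + c)) `^ a.
  by apply/funext => t; rewrite /powR_sum addrA.
rewrite /powR_sum -addrA; exact: is_derive_powR_shift.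
Qed.

Lemma is_derive_derive1_powR_sum c a x y : 0 < x + y + c ->
  is_derive x 1 (derive1 (powR_sum c a ^~ y))
    (a * ((a - 1) * powR_sum c (a - 1 - 1) x y)).
Proof.
(* The formula for the first derivative is available only where the base is positive. This holds
   near [x], which suffices to differentiate again. *)
move=> s0; apply: (@near_eq_is_derive _ _ _ (a *: powR_sum c (a - 1) ^~ y)).
  near=> t; rewrite derive1E.
  have t0 : 0 < t + y + c.
    have : - (y + c) < t by near: t; apply: lt_nbhsr; lra.
    lra.
  by have := is_derive_powR_sum a t0 => D; rewrite derive_val.
exact: is_deriveZ (is_derive_powR_sum (a - 1) s0).
Unshelve. all: by end_near. Qed.

Lemma powR_sum_good_escalating c a : -3 < c -> 1 < a ->
  good_escalating (powR_sum c a).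
Proof.
move=> c3 a1; split.
- by apply: powR_sum_escalating => //; left.
- move=> x y /adm_sum_ge3 xy3; have s0 : 0 < x + y + c by lra.
  have [D E] := is_derive_powR_sum a s0; split=> //.
  by rewrite derive1E E mulr_gt0 ?powR_gt0//; lra.
- move=> x y /adm_sum_ge3 xy3; have s0 : 0 < x + y + c by lra.
  have [D E] := is_derive_derive1_powR_sum a s0; split=> //.
  by rewrite derive1E E !mulr_ge0 ?powR_ge0//; lra.
- move=> x1 x2 y1 yx x21 _ _ /adm_sum_ge3 xy3 _; rewrite /powR_sum.
  (* Moving a unit between the arguments preserves their sum, so one term cancels on each side.
     Monotonicity of the power then reduces the rest to [x2 + y1 <= x1 + 1 + x2]. *)
  have -> : x1 + 1 + (y1 - 1) + c = x1 + y1 + c by ring.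
  by rewrite lerD2r ge0_ler_powR ?nnegrE//; lra.
Qed.

(** The index and [M_] unfold to the same edge sum, which leaves only the symmetry of [fZ]. *)
Lemma Z_presented_by a : presented_by (Z_ a) (fZ a).
Proof. by split=> // x y; rewrite /fZ (addrC x). Qed.

Lemma chi_presented_by a : presented_by (chi_ a) (fchi a).
Proof. by split=> // x y; rewrite /fchi addrC. Qed.

End ShiftedSum.

Theorem theorem8 (R : realType) (alpha : R) :
  [/\ 1 < alpha \/ alpha < 0 ->
        escalating_invariant (Z_ alpha) (fZ alpha) /\
        escalating_invariant (chi_ alpha) (fchi alpha),
      1 < alpha ->
        good_escalating_invariant (Z_ alpha) (fZ alpha) /\
        good_escalating_invariant (chi_ alpha) (fchi alpha)
    & 0 < alpha < 1 ->
        de_escalating_invariant (Z_ alpha) (fZ alpha) /\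
        de_escalating_invariant (chi_ alpha) (fchi alpha)].
Proof.
have cZ : -3 < -2 :> R by lra.
have cchi : -3 < 0 :> R by lra.
have PZ := @Z_presented_by R alpha; have Pchi := @chi_presented_by R alpha.
(* [fZ alpha] is convertible to [powR_sum (-2) alpha], so only [fchi] has to be rewritten. *)
split=> ha; do 2?split=> //; rewrite ?fchi_powR_sum.
- exact: (powR_sum_escalating cZ).
- exact: powR_sum_escalating.
- exact: (powR_sum_good_escalating cZ).
- exact: powR_sum_good_escalating.
- exact: (powR_sum_de_escalating cZ).
- exact: powR_sum_de_escalating.
Qed.
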